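(* Let $H$ be a separable, infinite dimensional real Hilbert space, let $C\subseteq H$ be a closed, convex set and let $\mathcal{F}$ be the set of all $f\in\mathcal{N}(C)$ with a fixed point. Then either $\mathcal{F}$ is meager in $\mathcal{N}(C)$ or it contains a dense open subset of $\mathcal{N}(C)$.
   Context: For a subset $C$ of a Hilbert space $H$ with norm $\|\cdot\|$, $\mathcal{N}(C)$ denotes the set of all nonexpansive mappings $f\colon C\to C$, i.e. mappings with $\|f(x)-f(y)\|\le\|x-y\|$ for all $x,y\in C$. It is endowed with the topology of pointwise convergence, i.e. the coarsest topology containing all sets $\{g\in\mathcal{N}(C): \|g(x)-f(x)\|<\varepsilon\}$ with $f\in\mathcal{N}(C)$, $x\in C$, $\varepsilon>0$. A subset of a topological space is meager if it is a countable union of nowhere dense sets. *)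

(* Defs.v *)
From HB Require Import structures.
From mathcomp Require Import all_boot all_order all_algebra.
From mathcomp Require Import all_classical all_reals all_analysis.

Set Implicit Arguments.
Unset Strict Implicit.
Unset Printing Implicit Defensive.

Import Order.TTheory GRing.Theory Num.Theory.
Import numFieldNormedType.Exports.

Local Open Scope classical_set_scope.
Local Open Scope ring_scope.

Definition nowhere_dense (T : topologicalType) (A : set T) : Prop :=
  (closure A)° = set0.

Definition meager (T : topologicalType) (A : set T) : Prop :=
  exists2 F : (set T)^nat,
    forall n, nowhere_dense (F n) & A = \bigcup_n F n.

Definition separable (T : topologicalType) : Prop :=
  exists2 D : set T, countable D & dense D.

Definition finite_dimensional (R : nzRingType) (V : lmodType R) : Prop :=
  exists (n : nat) (e : 'I_n -> V),
    forall x : V, exists c : 'I_n -> R, x = \sum_(i < n) c i *: e i.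

Section nonexpansive.
Context {R : realType} {H : normedModType R}.
Implicit Types C : set H.

Definition nonexpansive C (f : C -> C) : Prop :=
  forall x y : C, `|val (f x) - val (f y)| <= `|val x - val y|.

(* The set C, seen as a type, carries the topology induced by the norm, and the
   type of nonexpansive maps is a subspace of {ptws C -> C}; the resulting
   neighbourhoods are described by nbhs_nonexp below. *)
Definition nonexp C : topologicalType :=
  set_type [set f : {ptws C -> C} | nonexpansive f].

Definition with_fixpoint C : set (nonexp C) :=
  [set f | exists x : C, (val f : C -> C) x = x].

Let eval_continuous C (x : C) :
  continuous (fun f : nonexp C => val ((val f : C -> C) x)).
Proof.
have c1 : continuous (fun f : nonexp C => val f : {ptws C -> C}).
  move=> f; exact: (@initial_continuous _ {ptws C -> C} val).
have c2 : continuous (fun f : {ptws C -> C} => f x).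
  exact: (@proj_continuous _ (fun=> C) x).
have c3 : continuous (fun y : C => val y).
  move=> y; exact: (@initial_continuous C H val).
move=> f; apply: (@continuous_comp (nonexp C) C H _ val); last exact: c3.
apply: (@continuous_comp (nonexp C) {ptws C -> C} C _ (fun f => f x)).
  exact: c1.
exact: c2.
Qed.

Let ptws_base C (f : {ptws C -> C}) (A : set {ptws C -> C}) : nbhs f A ->
  exists (s : seq C) (eps : R), 0 < eps /\
    forall g : C -> C,
      (forall x, x \in s -> `|val (g x) - val (f x)| < eps) -> A g.
Proof.
pose G : set_system (C -> C) := [set A | exists (s : seq C) (eps : R), 0 < eps /\
  forall g : C -> C,
    (forall x, x \in s -> `|val (g x) - val (f x)| < eps) -> A g].
have GF : Filter G.
  split.
  - by exists [::], 1.
  - move=> P Q [s1 [e1 [e1_gt0 P1]]] [s2 [e2 [e2_gt0 P2]]].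
    exists (s1 ++ s2), (Num.min e1 e2); split; first by rewrite lt_min e1_gt0.
    move=> g gP; split; [apply: P1 | apply: P2] => x xs;
      by have := gP x; rewrite mem_cat xs ?orbT lt_min => /(_ isT)/andP[].
  - move=> P Q PQ [s [e [e_gt0 Ps]]]; exists s, e; split => // g /Ps.
    exact: PQ.
suff : G --> f by apply.
apply/cvg_sup => i B [V [[W [W' oW' <-] <-]] Wf] VB.
have /nbhs_ballP[e e_gt0 eW'] : nbhs (val (f i)) W' by exact: open_nbhs_nbhs.
exists [:: i], e; split => // g gi; apply: VB; apply: eW'.
by rewrite -ball_normE /= distrC gi ?mem_head.
Qed.

Lemma nbhs_nonexp C (f : nonexp C) (U : set (nonexp C)) :
  nbhs f U <-> exists (s : seq C) (eps : R), 0 < eps /\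
    forall g : nonexp C,
      (forall x, x \in s ->
        `|val ((val g : C -> C) x) - val ((val f : C -> C) x)| < eps) -> U g.
Proof.
split.
- move=> [_ [[A oA <-] Af] AU].
  have [|s [e [e_gt0 sA]]] := @ptws_base C (val f) A; first exact: open_nbhs_nbhs.
  by exists s, e; split => // g gs; apply: AU; exact: sA.
- move=> [s [e [e_gt0 sU]]]; apply: filterS sU _.
  elim: s => [|x s IHs]; first by apply: filterS filterT => g _ x.
  have fx : \forall g \near f,
      `|val ((val g : C -> C) x) - val ((val f : C -> C) x)| < e.
    have /cvgrPdist_lt/(_ e e_gt0) := @eval_continuous C x f.
    by apply: filterS => g; rewrite distrC.
  apply: filterS2 fx IHs => g gx gs y; rewrite inE => /predU1P[->//|]; exact: gs.
Qed.

End nonexpansive.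

Arguments with_fixpoint {R H} C.

(* Main.v *)
Require Import Defs.
From HB Require Import structures.
From mathcomp Require Import all_boot all_order all_algebra.
From mathcomp Require Import all_classical all_reals all_analysis.
From mathcomp Require Import ring lra.

Set Implicit Arguments.
Unset Strict Implicit.
Unset Printing Implicit Defensive.

Import Order.TTheory GRing.Theory Num.Theory.
Import numFieldNormedType.Exports.

Local Open Scope classical_set_scope.
Local Open Scope ring_scope.

(** The proof separates two kinds of sets, according to whether [C], seen from
    a point [q] of [C], [escapes]: for every finite set [X] of vectors there
    are arbitrarily far points [u] of [C] such that the direction of [u - q]
    is almost orthogonal to [X].  This says that [0] is a weak limit point of
    the unit directions of far points of [C].

    If [C] does not escape, then finitely many vectors detect a fixed share of
    the length of each far displacement [u - q].  Hence a large sphere around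
    [q] in [C] is covered by finitely many balls of radius strictly smaller
    than that of the sphere, by a factor that does not depend on the radius.
    If a nonexpansive map sends the centres of these balls into a fixed
    bounded set, then it sends the sphere into the ball that it bounds, and it
    has a fixed point ([fixpoint_of_sphere]).  The condition on the centres is
    open for pointwise convergence and holds for every map with values in a
    small ball.  Truncating a map by the metric projection onto a ball of [C]
    changes none of its values at a given finite set if the ball is large, so
    maps that have a fixed point together with a whole neighbourhood are dense
    ([fixpoint_of_finite_constraint]).

    If [C] escapes, the set of maps with a fixed point in the ball of radius
    [n] around [q] is nowhere dense for every [n].  Given [f] and finitely
    many points, take a far point [u] of [C] whose direction is almost
    orthogonal to these points and to their images.  Then [f] can be replaced
    by a map [g] whose main part ignores the direction of [u] and takes values
    orthogonal to it, plus a drift towards [u] which is small at the given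
    points but pushes the midpoint [a] of the segment from [q] to [u] further
    along it ([drift_map]): [g a] is farther than [a] from every point [w] of
    the ball.  No map [h] with [h a] close to [g a] can fix such a [w], as [h]
    does not increase the distance from [a] to [w] ([escape_perturbation]).

    The analytic inputs are the metric projection onto a closed convex set
    ([projection]) and the convergence of the resolvents [x_r], solutions of
    [h x - q = (1 + r) (x - q)], for [r] tending to [0] when they stay
    bounded. *)

(** * Convex sets and the inner product *)

Lemma convex_segment (R : realType) (H : normedModType R) (C : set H) (x y : H)
    (t : R) :
  convex_set C -> C x -> C y -> 0 <= t <= 1 -> C (x + t *: (y - x)).
Proof.
move=> cC Cx Cy /andP[t0 t1].
have := cC y x (Itv01 t0 t1); rewrite !inE => /(_ Cy Cx).
rewrite /conv/= /unstable.onem scalerBl scale1r scalerBr.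
by rewrite addrC -addrA (addrC (- _)).
Qed.

Lemma convex_from_segment (R : realType) (H : normedModType R) (C : set H) :
  (forall x y t, C x -> C y -> 0 <= t <= 1 -> C (x + t *: (y - x))) ->
  convex_set C.
Proof.
move=> cC x y l; rewrite !inE => Cx Cy.
have := cC y x l%:num Cy Cx; rewrite ge0 le1 => /(_ isT).
rewrite /conv/= /unstable.onem scalerBl scale1r scalerBr.
by rewrite [in X in _ -> X]addrC -addrA (addrC (- _)).
Qed.

Section hilbert.
Context {R : realType} {H : completeNormedModType R}.
Variable dot : {dot H for idfun}.
Hypothesis dot_norm : forall x : H, `|x| = Num.sqrt (dot x x).
Implicit Types (x y z u v w q : H) (t r c k M : R) (K C : set H).

Lemma dotC x y : dot x y = dot y x.
Proof. by rewrite hermC expr0 mul1r. Qed.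

Lemma dotDl x y z : dot (x + y) z = dot x z + dot y z.
Proof. exact: linearDl. Qed.

Lemma dotZl t x z : dot (t *: x) z = t * dot x z.
Proof. exact: linearZl_LR. Qed.

Lemma dotNl x z : dot (- x) z = - dot x z.
Proof. exact: linearNl. Qed.

Lemma dot0l z : dot 0 z = 0.
Proof. exact: linear0l. Qed.

Lemma dotDr x y z : dot z (x + y) = dot z x + dot z y.
Proof. by rewrite !(dotC z) dotDl. Qed.

Lemma dotZr t x z : dot z (t *: x) = t * dot z x.
Proof. by rewrite !(dotC z) dotZl. Qed.

Lemma dotNr x z : dot z (- x) = - dot z x.
Proof. by rewrite !(dotC z) dotNl. Qed.

Definition dotE := (dotDl, dotDr, dotNl, dotNr, dotZl, dotZr).

Lemma sqr_norm x : `|x| ^+ 2 = dot x x.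
Proof.
rewrite dot_norm sqr_sqrtr//; have [->|x0] := eqVneq x 0; first by rewrite dot0l.
exact/ltW/neq0_dnorm_gt0.
Qed.

Lemma sqr_normD x y : `|x + y| ^+ 2 = `|x| ^+ 2 + 2 * dot x y + `|y| ^+ 2.
Proof. by rewrite !sqr_norm !dotE (dotC y x); ring. Qed.

Lemma sqr_normB x y : `|x - y| ^+ 2 = `|x| ^+ 2 - 2 * dot x y + `|y| ^+ 2.
Proof. by rewrite sqr_normD dotNr normrN mulrN. Qed.

Lemma cauchy_schwarz x y : `|dot x y| <= `|x| * `|y|.
Proof.
have [->|y0] := eqVneq y 0; first by rewrite dotC dot0l !normr0 mulr0.
have yp : 0 < `|y| ^+ 2 by rewrite exprn_gt0 ?normr_gt0.
rewrite -(@ler_pXn2r _ 2)// ?nnegrE ?mulr_ge0// real_normK ?num_real//.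
have := sqr_ge0 `| `|y| ^+ 2 *: x - dot x y *: y|.
rewrite sqr_normB !dotE !normrZ !exprMn !real_normK ?num_real//.
move: yp; set Y := `|y| ^+ 2; set X := `|x| ^+ 2; set D := dot x y => yp h.
by rewrite -(ler_pM2l yp); nra.
Qed.

Lemma dot_le x y : dot x y <= `|x| * `|y|.
Proof. exact: le_trans (ler_norm _) (cauchy_schwarz _ _). Qed.

(** Both limits taken below, of a minimizing sequence and of the resolvents,
    come with such a bound on the square of the distances. *)
Lemma sqr_le_cvg (u : nat -> H) (e : nat -> R) :
  e @ \oo --> 0 -> (forall m n, `|u m - u n| ^+ 2 <= e m + e n) ->
  cvg (u @ \oo).
Proof.
move=> e0 ue; apply: cauchy_cvg; apply: cauchy_exP => eps eps0.
have /cvgrPdist_lt/(_ (eps ^+ 2 / 2)) := e0.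
rewrite divr_gt0 ?exprn_gt0// => /(_ isT)[N _ eN].
have eN' n : (N <= n)%N -> e n < eps ^+ 2 / 2.
  move=> /eN/=; rewrite sub0r normrN; exact/le_lt_trans/ler_norm.
exists (u N); exists N => // n Nn; rewrite -ball_normE/=.
rewrite -(@ltr_pXn2r _ 2)// ?nnegrE ?(ltW eps0)//.
rewrite (le_lt_trans (ue _ _))//.
have := eN' n Nn; have := eN' N (leqnn _); lra.
Qed.

(** * Metric projection *)

(** A sequence in [K] minimizing the distance to [x] is Cauchy because the
    midpoint of two of its terms is again in [K]; moving the minimizer slightly
    towards [z] cannot bring it closer to [x], which is the inequality. *)
Lemma projection_exists K x :
  closed K -> convex_set K -> K !=set0 ->
  exists2 p, K p & forall z, K z -> dot (x - p) (z - p) <= 0.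
Proof.
move=> clK cvK [z0 Kz0].
pose A := [set `|x - z| ^+ 2 | z in K].
have A0 : A !=set0 by exists (`|x - z0| ^+ 2), z0.
have Alb : has_lbound A by exists 0 => _ [z _ <-]; exact: sqr_ge0.
have AlE z : K z -> inf A <= `|x - z| ^+ 2.
  by move=> Kz; apply: ge_inf => //; exists z.
have /choice[u uP] : forall n : nat, exists z,
    K z /\ `|x - z| ^+ 2 < inf A + n.+1%:R^-1.
  move=> n; have [|_ [z Kz <-] zlt] := @inf_adherent _ A n.+1%:R^-1 _ (conj A0 Alb).
    by rewrite invr_gt0.
  by exists z.
have e0 : (fun n : nat => 2 * n.+1%:R^-1 : R) @ \oo --> (0 : R).
  rewrite -[X in _ --> X](mulr0 2); apply: cvgMr; exact: cvg_harmonic.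
have cu : cvg (u @ \oo).
  apply: (sqr_le_cvg e0) => m n.
  have [Km um] := uP m; have [Kn un] := uP n.
  have : K (u m + 2^-1 *: (u n - u m)).
    by apply: convex_segment => //; lra.
  have um' : `|x - u m| ^+ 2 <= inf A + m.+1%:R^-1 by exact: ltW.
  move: un; rewrite (distrC (u m)); set d := u n - u m.
  have -> : x - u n = (x - u m) - d by rewrite opprB addrA subrK.
  rewrite -/d => un /AlE; rewrite opprD addrA; move: un um'.
  set p := x - u m; clearbody d p.
  rewrite !sqr_normB dotZr normrZ exprMn ger0_norm//.
  move: (m.+1%:R^-1 : R) (n.+1%:R^-1 : R) => *; lra.
pose p := lim (u @ \oo).
have up : u @ \oo --> p by exact: cu.
have Kp : K p.
  by apply: (closed_cvg K clK _ _ up); apply: nearW => n; have [] := uP n.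
exists p => // z Kz.
have xp : `|x - p| ^+ 2 <= inf A.
  have c1 : (fun n => inf A + n.+1%:R^-1) @ \oo --> inf A + 0.
    by apply: cvgD; [exact: cvg_cst|exact: cvg_harmonic].
  have c2 : (fun n => `|x - u n| ^+ 2) @ \oo --> `|x - p| ^+ 2.
    have c3 : (fun n => `|x - u n|) @ \oo --> `|x - p|.
      by apply: cvg_norm; apply: cvgB => //; exact: cvg_cst.
    exact: (cvgM c3 c3).
  rewrite -[inf A]addr0; apply: ler_cvg_to c2 c1 _; apply: nearW => n.
  by have [_ /ltW] := uP n.
rewrite leNgt; apply/negP => dp.
set a := dot _ _ in dp; set b := `|z - p| ^+ 2.
have b0 : 0 <= b by exact: sqr_ge0.
(* This [t] is at most [1] and satisfies [t * b < 2 * a], so that moving by it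
   strictly decreases the distance to [x]. *)
pose t := a / (a + b).
have ab0 : 0 < a + b by rewrite ltr_pwDl.
have t0 : 0 < t by rewrite divr_gt0.
have t1 : t <= 1 by rewrite ler_pdivrMr// mul1r lerDl.
have : K (p + t *: (z - p)) by apply: convex_segment => //; rewrite (ltW t0).
move=> /AlE; rewrite opprD addrA sqr_normB dotZr -/a normrZ exprMn -/b.
rewrite real_normK ?num_real// => h.
have : t * b < 2 * a.
  have : t * b <= 1 * b by rewrite ler_wpM2r.
  have : t * (a + b) = a by rewrite divfK// gt_eqF.
  nra.
have : 2 * (t * a) <= t * (t * b) by nra.
nra.
Qed.

(** Adding the variational inequalities at two points bounds the square of
    [`|P x - P y|] by [dot (x - y) (P x - P y)]. *)
Lemma projection K : closed K -> convex_set K -> K !=set0 ->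
  exists P : H -> H, [/\ forall x, K (P x), {in K, forall x, P x = x} &
    forall x y, `|P x - P y| <= `|x - y|].
Proof.
move=> clK cvK K0.
have /choice[P PP] : forall x, exists p,
    K p /\ forall z, K z -> dot (x - p) (z - p) <= 0.
  by move=> x; have [p ? ?] := projection_exists x clK cvK K0; exists p.
exists P; split=> [x|x /set_mem Kx|x y]; first by have [] := PP x.
  have [_ /(_ _ Kx)] := PP x; rewrite -sqr_norm => h.
  apply/esym/eqP; rewrite -subr_eq0 -normr_eq0 -sqrf_eq0 eq_le h; exact: sqr_ge0.
have [Kx hx] := PP x; have [Ky hy] := PP y.
have h : `|P x - P y| ^+ 2 <= dot (x - y) (P x - P y).
  move: (hx _ Ky) (hy _ Kx); rewrite sqr_norm.
  rewrite !dotE (dotC (P y) (P x)); lra.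
have [->|n0] := eqVneq (P x - P y) 0; first by rewrite normr0.
have np : 0 < `|P x - P y| by rewrite normr_gt0.
by rewrite -(ler_pM2r np) -expr2 (le_trans h)// dot_le.
Qed.

(** * Fixed points of nonexpansive maps *)

(** The equation says that [x] is fixed by the contraction
    [x |-> q + (h x - q) / (1 + r)]. *)
Lemma resolvent_exists (h : H -> H) q r : 0 < r ->
  (forall x y, `|h x - h y| <= `|x - y|) ->
  exists x, h x - q = (1 + r) *: (x - q).
Proof.
move=> r0 hN; pose k := (1 + r)^-1.
have r1 : 0 < 1 + r by rewrite addr_gt0.
have k0 : 0 <= k by rewrite invr_ge0 ltW.
pose T x := q + k *: (h x - q).
have [] := @banach_fixed_point R H setT (totalfun T).
- exists (NngNum k0); split; first by rewrite /= invf_lt1// ltrDl.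
  move=> [x y] _ /=; rewrite /totalfun_ /T opprD addrACA subrr add0r.
  rewrite -scalerBr normrZ ger0_norm// ler_wpM2l//.
  by rewrite opprB addrA subrK.
- exact: closedT.
- by exists q.
move=> x _; rewrite /totalfun_ /T => xT; exists x.
have -> : x - q = k *: (h x - q) by rewrite {1}xT addrC addKr.
by rewrite scalerA mulfV ?scale1r// gt_eqF.
Qed.

(** As [h] is nonexpansive, [id - h] is monotone; applied to [x] and [y] this
    gives [dot (c a - r b) (a - b) <= 0] for [a = x - q] and [b = y - q].  So the
    distance to [q] increases as the parameter decreases to [0], and its square
    controls the square of the distance between two resolvents: a bounded
    family of resolvents is Cauchy. *)
Lemma resolvent_monotone (h : H -> H) q r c x y :
  (forall x y, `|h x - h y| <= `|x - y|) -> 0 < r -> r <= c ->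
  h y - q = (1 + r) *: (y - q) -> h x - q = (1 + c) *: (x - q) ->
  `|x - q| ^+ 2 + `|x - y| ^+ 2 <= `|y - q| ^+ 2.
Proof.
move=> hN r0 rc hy hx.
have := hN x y; rewrite -(@ler_pXn2r _ 2)// ?nnegrE//.
have -> : h x - h y = (1 + c) *: (x - q) - (1 + r) *: (y - q).
  by rewrite -hx -hy opprB addrA subrK.
have -> : x - y = (x - q) - (y - q) by rewrite opprB addrA subrK.
move: (x - q) (y - q) => a b.
have ca0 := sqr_ge0 `|c *: a - r *: b|.
have -> : (1 + c) *: a - (1 + r) *: b = (a - b) + (c *: a - r *: b).
  by rewrite !scalerDl !scale1r opprD addrACA.
rewrite (sqr_normD (a - b)) => le0.
have : (dot (a - b) (c *: a - r *: b) : R) <= 0.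
  move: le0 ca0; lra.
rewrite !dotE (dotC b a) -!sqr_norm => {}le0.
have [<-|ab] := eqVneq a b; first by rewrite subrr normr0 expr0n addr0.
have : 0 < `|a - b| ^+ 2 by rewrite exprn_gt0// normr_gt0 subr_eq0.
move: le0; rewrite !sqr_normB.
move: (dot a b : R) (`|a| ^+ 2) (`|b| ^+ 2) => D A B le0 ab_gt0.
suff : A <= D by lra.
rewrite leNgt; apply/negP => DA.
have : 0 <= (c - r) * (A - D) by rewrite mulr_ge0 ?subr_ge0// ltW.
have : 0 < r * (A - 2 * D + B) by rewrite mulr_gt0.
lra.
Qed.

(** The condition on the sphere keeps the resolvents inside the ball: if [x]
    were outside, then comparing [h x] with [h u], where [u] is the radial
    projection of [x] on the sphere, would give [`|h x - q| <= `|x - q|],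
    against the equation of [x].  The limit of the resolvents is fixed. *)
Lemma fixpoint_of_sphere C (h : H -> H) q r :
  convex_set C -> C q -> 0 < r -> (forall x, C (h x)) ->
  (forall x y, `|h x - h y| <= `|x - y|) ->
  (forall u, C u -> `|u - q| = r -> `|h u - q| <= r) ->
  exists2 x, C x & h x = x.
Proof.
move=> cC Cq r0 hC hN hr.
have /choice[x xP] : forall n : nat, exists x, h x - q = (1 + n.+1%:R^-1) *: (x - q).
  by move=> n; apply: resolvent_exists => //; rewrite invr_gt0.
have xr n : `|x n - q| <= r.
  rewrite leNgt; apply/negP => rx.
  have l0 : 0 < `|x n - q| by exact: lt_trans rx.
  pose c := (1 + n.+1%:R^-1 : R).
  have c1 : 1 < c by rewrite ltrDl invr_gt0.
  have c0 : 0 < c by exact: lt_trans c1.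
  have Cx : C (x n).
    have -> : x n = q + c^-1 *: (h (x n) - q).
      by rewrite xP scalerA mulVf ?gt_eqF// scale1r addrC subrK.
    by apply: convex_segment => //; rewrite invr_ge0 (ltW c0) invf_le1// ltW.
  pose t := r / `|x n - q|.
  have t0 : 0 <= t by rewrite divr_ge0// ltW.
  have t1 : t <= 1 by rewrite ler_pdivrMr// mul1r ltW.
  pose u := q + t *: (x n - q).
  have uq : u - q = t *: (x n - q) by rewrite /u addrC addKr.
  have Cu : C u by apply: convex_segment => //; rewrite t0.
  have ur : `|u - q| = r by rewrite uq normrZ ger0_norm// divfK// gt_eqF.
  have xu : `|x n - u| = `|x n - q| - r.
    have -> : x n - u = (1 - t) *: (x n - q).
      by rewrite /u opprD addrA scalerBl scale1r.
    by rewrite normrZ ger0_norm ?subr_ge0// mulrBl mul1r divfK// gt_eqF.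
  have : `|h (x n) - q| <= `|x n - q|.
    rewrite (le_trans (ler_distD (h u) _ _))//.
    have := hr _ Cu ur; have := hN (x n) u; rewrite xu; lra.
  by rewrite xP normrZ gtr0_norm// -ler_pdivlMr// divff ?gt_eqF// leNgt c1.
pose a n := `|x n - q| ^+ 2.
have xmono m n : (m <= n)%N -> `|x m - x n| ^+ 2 <= a n - a m.
  move=> mn; have := @resolvent_monotone h q n.+1%:R^-1 m.+1%:R^-1 (x m) (x n) hN.
  rewrite invr_gt0 ltr0Sn lef_pV2 ?posrE// ler_nat ltnS mn => /(_ _ _ _ _).
  by rewrite -lerBrDl; apply.
have amono : {homo a : n m / (n <= m)%N >-> n <= m}.
  by move=> m n /xmono h1; rewrite -subr_ge0 (le_trans _ h1)// sqr_ge0.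
have aub : has_ubound (range a).
  by exists (r ^+ 2) => _ [n _ <-]; rewrite ler_pXn2r ?nnegrE// ltW.
have ac := nondecreasing_cvgn amono aub.
have ale n : a n <= sup (range a) by apply: ub_le_sup => //; exists n.
have cx : cvg (x @ \oo).
  apply: (@sqr_le_cvg _ (fun n => sup (range a) - a n)).
    by rewrite -(subrr (sup (range a))); apply: cvgB => //; exact: cvg_cst.
  move=> m n; have := ale m; have := ale n.
  have [/xmono|/ltnW/xmono] := leqP m n; last rewrite distrC; lra.
pose l := lim (x @ \oo).
have xl : x @ \oo --> l by exact: cx.
have hl : h l = l.
  have hc : h (x n) @[n --> \oo] --> h l.
    apply/cvgrPdist_lt => e e0; move/cvgrPdist_lt/(_ e e0): xl.
    by apply: filterS => n; exact/le_lt_trans/hN.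
  have : h (x n) - q @[n --> \oo] --> (1 + 0 : R) *: (l - q).
    under eq_cvg do rewrite xP.
    apply: cvgZ; last by apply: cvgB => //; exact: cvg_cst.
    by apply: cvgD; [exact: cvg_cst|exact: cvg_harmonic].
  have hcq : h (x n) - q @[n --> \oo] --> h l - q.
    by apply: cvgB => //; exact: cvg_cst.
  move=> /(cvg_unique _ hcq)/= /(_ _)/(congr1 (fun z => z + q)).
  by rewrite addr0 scale1r !subrK; apply.
by exists l => //; rewrite -hl.
Qed.

(** * Slices of a ball and orthogonalization *)

Lemma closed_ball_norm q r : closed [set x : H | `|x - q| <= r].
Proof.
have -> : [set x : H | `|x - q| <= r] = (fun x => `|x - q|) @^-1` [set t | t <= r].
  by [].
apply: closed_comp; last exact: closed_le.
move=> x _; apply: cvg_norm; apply: cvgB => //; exact: cvg_cst.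
Qed.

Lemma dot_continuous v : continuous (fun u => dot u v : R).
Proof.
move=> u; apply/cvgrPdist_lt => e e0.
have v0 : 0 < `|v| + 1 by rewrite ltr_wpDl.
have ev0 : 0 < e / (`|v| + 1) by rewrite divr_gt0.
have := nbhsx_ballx u _ ev0; apply: filterS => w.
rewrite -ball_normE/= ltr_pdivlMr// => uw.
rewrite -dotNl -dotDl (le_lt_trans (cauchy_schwarz _ _))//.
by apply: le_lt_trans uw; rewrite ler_wpM2l// lerDl.
Qed.

Lemma closed_orthogonal q v : closed [set x : H | dot (x - q) v = 0].
Proof.
apply: (@preimage_closed _ _ (fun x => dot (x - q) v : R) [set t | t = 0]).
  move=> x _; apply: (@continuous_comp _ _ _ (fun x => x - q)
    (fun u => dot u v : R)).
    by apply: cvgB => //; exact: cvg_cst.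
  exact: dot_continuous.
by apply: accessible_closed_set1; apply: hausdorff_accessible; exact: norm_hausdorff.
Qed.

Lemma closed_ball_slice C q v r : closed C ->
  closed [set x | [/\ C x, `|x - q| <= r & dot (x - q) v = 0]].
Proof.
move=> clC.
have -> : [set x | [/\ C x, `|x - q| <= r & dot (x - q) v = 0]] =
    C `&` [set x | `|x - q| <= r] `&` [set x | dot (x - q) v = 0].
  by apply/seteqP; split => x /= [] => [? ? ?|[]].
apply: closedI; last exact: closed_orthogonal.
by apply: closedI => //; exact: closed_ball_norm.
Qed.

Lemma convex_ball_slice C q v r : convex_set C ->
  convex_set [set x | [/\ C x, `|x - q| <= r & dot (x - q) v = 0]].
Proof.
move=> cC; apply: convex_from_segment => x y t [Cx xr xv] [Cy yr yv] t01.
have xyE : x + t *: (y - x) - q = (1 - t) *: (x - q) + t *: (y - q).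
  rewrite addrAC scalerBl scale1r -[RHS]addrA; congr (_ + _).
  by rewrite [RHS]addrC -scalerBr opprB addrA subrK.
have t1 : 0 <= 1 - t by move: t01 => /andP[_]; rewrite subr_ge0.
have t0 : 0 <= t by case/andP: t01.
split; first exact: convex_segment.
- rewrite xyE (le_trans (ler_normD _ _))// !normrZ !ger0_norm//.
  have : (1 - t) * `|x - q| <= (1 - t) * r by rewrite ler_wpM2l.
  have : t * `|y - q| <= t * r by rewrite ler_wpM2l.
  lra.
- by rewrite xyE dotDl !dotZl xv yv !mulr0 addr0.
Qed.

(** One step of the Gram-Schmidt process: [v] is the component of [u]
    orthogonal to the span of [X].  The size of the removed part is bounded
    linearly by the inner products of [u] with [X], so a vector almost
    orthogonal to [X] is close to a vector orthogonal to [X].  The second clause expresses that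
    [u - v] is in the span of [X]. *)
Lemma orthogonalization (X : seq H) : exists2 L, 0 <= L & forall u, exists v,
  [/\ {in X, forall x, dot v x = 0},
      forall w, {in X, forall x, dot w x = 0} -> dot w (u - v) = 0 &
      forall c, 0 <= c -> {in X, forall x, `|dot u x| <= c} -> `|u - v| <= L * c].
Proof.
elim: X => [|x X [L L0 IH]].
  exists 0 => // u; exists u; split => // [w _|c _ _].
    by rewrite subrr dotC dot0l.
  by rewrite subrr normr0 mul0r.
have [x' [x'X x'w _]] := IH x.
pose g := (1 + L * `|x|) / `|x'|.
have g0 : 0 <= g by rewrite divr_ge0 ?addr_ge0 ?mulr_ge0.
exists (L + g); first exact: addr_ge0.
move=> u; have [u' [u'X u'w u'c]] := IH u.
pose k := (dot u' x' : R) / `|x'| ^+ 2.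
have x'x : dot x' x = `|x'| ^+ 2.
  by rewrite -[in LHS](subrK x' x) dotDr x'w// add0r sqr_norm.
have kx : k * `|x'| ^+ 2 = dot u' x'.
  rewrite /k; have [->|x'0] := eqVneq x' 0; first by rewrite dotC dot0l mul0r mul0r.
  by rewrite divfK// expf_neq0// normr_eq0.
have vX z : z \in X -> dot (u' - k *: x') z = 0.
  by move=> zX; rewrite !dotE u'X// x'X// mulr0 subr0.
have u'x : dot u' x = dot u' x'.
  by rewrite -[in LHS](subrK x' x) dotDr x'w// add0r.
exists (u' - k *: x'); split=> [z|w wX|c c0 uc].
- rewrite inE => /predU1P[->|/vX//].
  by rewrite !dotE x'x kx u'x subrr.
- have wX' : {in X, forall z, dot w z = 0} by move=> z zX; rewrite wX// inE zX orbT.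
  have wx' : dot w x' = 0.
    have := x'w w wX'; rewrite !dotE wX ?mem_head// add0r => /eqP.
    by rewrite oppr_eq0 => /eqP.
  by rewrite opprB addrCA addrC dotDr u'w// dotZr wx' mulr0 addr0.
- have {}u'c : `|u - u'| <= L * c.
    by apply: u'c => // z zX; apply: uc; rewrite inE zX orbT.
  have -> : u - (u' - k *: x') = (u - u') + k *: x' by rewrite opprB addrCA addrC.
  rewrite (le_trans (ler_normD _ _))// mulrDl lerD//.
  rewrite normrZ /k normrM normfV normrX normr_id -mulrA.
  have [->|x'0] := eqVneq x' 0.
    by rewrite dotC dot0l normr0 mul0r mulr_ge0.
  have x'p : 0 < `|x'| by rewrite normr_gt0.
  rewrite expr2 invfM -mulrA mulVf ?gt_eqF// mulr1.
  rewrite /g mulrAC ler_pM2r ?invr_gt0// -u'x.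
  have -> : (dot u' x : R) = dot u x - dot (u - u') x.
    by rewrite !dotE opprD opprK addrA subrr add0r.
  rewrite (le_trans (ler_normB _ _))//.
  rewrite mulrDl mul1r lerD ?uc ?mem_head// (le_trans (cauchy_schwarz _ _))//.
  by rewrite mulrAC ler_wpM2r.
Qed.

(** * Finite constraints that force a fixed point *)

Definition escapes C q : Prop := forall (X : seq H) c r, 0 < c ->
  exists u, [/\ C u, r <= `|u - q| &
    {in X, forall x, `|dot (u - q) x| < c * `|u - q|}].

(** When [C] does not escape, each far [u] satisfies
    [c * `|u - q| <= `|dot (u - q) x|] for some [x] in the finite set [X], and
    the point [q + l x] or [q - l x], for [l] suitably proportional to the
    radius [r], is at distance at most [r (1 - t / 2)] from [u].  The required
    points are the projections of these points on [C]. *)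
Lemma fixpoint_of_finite_constraint C q M :
  closed C -> convex_set C -> C q -> 0 <= M -> ~ escapes C q ->
  exists2 cs : seq H, {in cs, forall p, C p} &
    forall h : H -> H, (forall x, C (h x)) ->
      (forall x y, `|h x - h y| <= `|x - y|) ->
      {in cs, forall p, `|h p - q| <= M} -> exists2 x, C x & h x = x.
Proof.
move=> clC cC Cq M0 nesc.
have [X [c [r0 [c0 far]]]] : exists (X : seq H) c r, 0 < c /\
    forall u, C u -> r <= `|u - q| -> exists2 x, x \in X &
      c * `|u - q| <= `|dot (u - q) x|.
  apply: contrapT => nX; apply: nesc => X c r c0; apply: contrapT => nu.
  apply: nX; exists X, c, r; split=> // u Cu ru; apply: contrapT => nx.
  apply: nu; exists u; split=> // x xX; rewrite ltNge; apply/negP => xc.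
  by apply: nx; exists x.
have [P [PC Pid PN]] := projection clC cC (ex_intro _ q Cq).
(* [B] bounds the squared norms on [X]; the summand [c ^+ 2] makes it positive
   and gives [t <= 1]. *)
pose B := c ^+ 2 + \sum_(x <- X) `|x| ^+ 2.
have cB : c ^+ 2 <= B by rewrite lerDl sumr_ge0// => x _; exact: sqr_ge0.
have B0 : 0 < B by rewrite (lt_le_trans _ cB)// exprn_gt0.
have xB x : x \in X -> `|x| ^+ 2 <= B.
  move=> xX; rewrite /B (big_rem x xX)/= addrCA lerDl addr_ge0 ?sqr_ge0//.
  by rewrite sumr_ge0// => y _; exact: sqr_ge0.
pose t := c ^+ 2 / B.
have t0 : 0 < t by rewrite divr_gt0// exprn_gt0.
have t1 : t <= 1 by rewrite ler_pdivrMr// mul1r.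
pose r := `|r0| + 1 + 2 * M / t.
have Mt : 0 <= 2 * M / t by rewrite divr_ge0 ?(ltW t0)// mulr_ge0.
have r0r : r0 <= r by have := ler_norm r0; rewrite /r; lra.
have rp : 0 < r by have := normr_ge0 r0; rewrite /r; lra.
have rM : M <= t / 2 * r.
  have : t * (2 * M / t) = 2 * M by rewrite mulrC divfK// gt_eqF.
  have : 0 <= t * (`|r0| + 1) by rewrite mulr_ge0 ?addr_ge0// ltW.
  by rewrite /r; lra.
pose l := r * c / B.
have l0 : 0 <= l by rewrite divr_ge0 ?(ltW B0)// mulr_ge0// ltW.
exists [seq P (q + l *: y) | y <- X ++ [seq - x | x <- X]].
  by move=> _ /mapP[y _ ->].
move=> h hC hN hcs.
apply: (fixpoint_of_sphere cC Cq rp hC hN) => u Cu ur.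
have [|x xX] := far u Cu; first by rewrite ur.
rewrite ur => xc.
have [y [yX yx yc]] : exists y, [/\ y \in X ++ [seq - x | x <- X],
    `|y| = `|x| & c * r <= dot (u - q) y].
  move: xc; case: (ger0P (dot (u - q) x : R)) => _ xc.
    by exists x; rewrite mem_cat xX.
  exists (- x); rewrite normrN dotNr mem_cat; split=> //.
  by rewrite (map_f (fun x => - x) xX) orbT.
set p := P (q + l *: y).
have up : `|u - p| <= r * (1 - t / 2).
  have tr : 0 <= r * (1 - t / 2) by rewrite mulr_ge0 ?(ltW rp)//; lra.
  rewrite -(Pid u (mem_set Cu)) (le_trans (PN _ _))//.
  rewrite -(@ler_pXn2r _ 2)// ?nnegrE//.
  rewrite opprD addrA sqr_normB ur dotZr normrZ exprMn ger0_norm// yx.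
  have := xB x xX.
  have lB : l * B = r * c by rewrite /l divfK// gt_eqF.
  have lc : l * c = r * t by rewrite /l /t expr2 mulrAC !mulrA.
  move: (`|x| ^+ 2) yc => Y; move: (dot (u - q) y : R) => D yc YB.
  have h1 : l * (c * r) <= l * D by rewrite ler_wpM2l.
  have h2 : l ^+ 2 * Y <= l ^+ 2 * B by rewrite ler_wpM2l// sqr_ge0.
  have h3 : l ^+ 2 * B = r ^+ 2 * t by rewrite expr2 -mulrA lB mulrCA lc mulrA expr2.
  have h4 : l * (c * r) = r ^+ 2 * t by rewrite mulrA lc mulrAC expr2.
  have h5 : 0 <= r ^+ 2 * t ^+ 2 by rewrite mulr_ge0 ?sqr_ge0.
  have -> : (r * (1 - t / 2)) ^+ 2 = r ^+ 2 - r ^+ 2 * t + r ^+ 2 * t ^+ 2 / 4.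
    by field.
  lra.
rewrite (le_trans (ler_distD (h p) _ _))//.
have : `|h p - q| <= M by apply: hcs; exact: map_f.
have := hN u p; lra.
Qed.

(** * Perturbations without fixed points in a given ball *)

(** The far point given by [escapes] is pulled back along its segment from
    [q] to the prescribed distance [r]; its displacement then differs by at
    most [1] from a vector orthogonal to [X]. *)
Lemma escape_direction C q (X : seq H) r : convex_set C -> C q -> escapes C q ->
  0 < r -> exists u v, [/\ C u, `|u - q| = r, {in X, forall x, dot v x = 0},
    dot (u - q - v) v = 0 & `|u - q - v| <= 1].
Proof.
move=> cC Cq esc r0.
have [L L0 LP] := orthogonalization X.
have Lr0 : 0 < (L + 1) * r by rewrite mulr_gt0// ltr_wpDl.
pose c := ((L + 1) * r)^-1.
have c0 : 0 < c by rewrite invr_gt0.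
have [u [Cu ru uX]] := esc X c r c0.
have u0 : 0 < `|u - q| by exact: lt_le_trans ru.
pose t := r / `|u - q|.
have t0 : 0 <= t by rewrite divr_ge0// ltW.
have tu : t * `|u - q| = r by rewrite divfK// gt_eqF.
have t1 : t <= 1 by rewrite ler_pdivrMr// mul1r.
pose w := t *: (u - q).
have [v [vX vw vL]] := LP w.
have qw : q + w - q = w by rewrite addrC addKr.
exists (q + w), v; rewrite qw; split=> //.
- by apply: convex_segment => //; rewrite t0.
- by rewrite normrZ ger0_norm.
- by rewrite dotC vw.
- rewrite (le_trans (vL (c * r) _ _))//.
  + by rewrite mulr_ge0// ltW.
  + move=> x xX; rewrite /w dotZl normrM ger0_norm// -tu mulrCA.
    by rewrite ler_wpM2l// ltW// uX.
  + have -> : L * (c * r) = L / (L + 1).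
      by rewrite /c invfM -mulrA mulVf ?gt_eqF// mulr1.
    by rewrite ler_pdivrMr ?ltr_wpDl// mul1r lerDl.
Qed.

(** The Lipschitz estimate for the map of [drift_map], in the orthogonal
    decomposition of the displacement with components [p] and [S V].  The
    part along the drift contracts by [1 - e] and the other part by [k]; by
    the Cauchy inequality, the interaction term [c S] costs only
    [(c S) ^+ 2 / (1 - k ^+ 2)], which the contraction along the drift pays
    for. *)
Lemma drift_estimate (p S V k c e : R) : 0 <= p -> 0 <= S -> 0 <= k < 1 ->
  0 <= e <= 1 -> c ^+ 2 <= e * (1 - k ^+ 2) * V ^+ 2 ->
  (k * p + c * S) ^+ 2 + ((1 - e) * S * V) ^+ 2 <= p ^+ 2 + (S * V) ^+ 2.
Proof.
move=> p0 S0 /andP[k0 k1] /andP[e0 e1] cV.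
have k2 : 0 < 1 - k ^+ 2 by rewrite subr_gt0 expr_lt1.
have h1 : (k * p + c * S) ^+ 2 * (1 - k ^+ 2) <=
    (p ^+ 2 + e * (S * V) ^+ 2) * (1 - k ^+ 2).
  have h2 : S ^+ 2 * c ^+ 2 <= S ^+ 2 * (e * (1 - k ^+ 2) * V ^+ 2).
    by rewrite ler_wpM2l// sqr_ge0.
  have := sqr_ge0 ((1 - k ^+ 2) * p - k * (c * S)).
  move: h2; rewrite !exprMn; lra.
rewrite ler_pM2r// in h1.
have h3 : (1 - e) ^+ 2 * (S * V) ^+ 2 <= (1 - e) * (S * V) ^+ 2.
  rewrite ler_wpM2r ?sqr_ge0// expr2 ler_piMl ?subr_ge0//; lra.
rewrite -mulrA [((1 - e) * _) ^+ 2]exprMn; lra.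
Qed.

(** The drift moves a point at level [t] of the segment from [0] to [1] to
    level [ramp e t], which is higher unless [t = 1]. *)
Definition ramp (e t : R) : R := Num.max 0 (Num.min 1 (e + (1 - e) * t)).

Lemma ramp01 e t : 0 <= ramp e t <= 1.
Proof. by rewrite /ramp le_max lexx ge_max ler01 ge_min lexx. Qed.

Lemma rampE e t : 0 <= e <= 1 -> 0 <= t <= 1 -> ramp e t = e + (1 - e) * t.
Proof.
move=> e01 t01; rewrite /ramp.
have h0 : 0 <= (1 - e) * t by apply: mulr_ge0; lra.
have h1 : 0 <= (1 - e) * (1 - t) by apply: mulr_ge0; lra.
rewrite min_r ?max_r//; lra.
Qed.

Lemma ramp_lip e s t : 0 <= e <= 1 ->
  `|ramp e s - ramp e t| <= (1 - e) * `|s - t|.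
Proof.
move=> e01; have e1 : 0 <= 1 - e by lra.
have -> : (1 - e) * `|s - t| = `|(e + (1 - e) * s) - (e + (1 - e) * t)|.
  by rewrite -[X in X * _]ger0_norm// -normrM; congr `|_|; ring.
rewrite /ramp; move: (e + _) (e + _) => a b; rewrite /Num.max /Num.min.
have := ler_norm (a - b); have := ler_norm (b - a); rewrite (distrC b a).
by case: (ltP 1 a) => ? ; case: (ltP 1 b) => ?; do 2?case: ltP => ?;
  rewrite ler_norml; lra.
Qed.

Lemma sqr_norm_slice v (a : H) t : dot a v = 0 ->
  `|a + t *: v| ^+ 2 = `|a| ^+ 2 + (t * `|v|) ^+ 2.
Proof.
move=> av; rewrite sqr_normD dotZr av mulr0 mulr0 addr0 normrZ !exprMn.
by rewrite real_normK ?num_real.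
Qed.

(** The map is [g x = q + (1 - r) A + r D], where [A] is obtained from [f] by
    erasing the component of [x - q] along [v], projecting on [C], applying
    [f], projecting on the part of [C] orthogonal to [v] in the ball of radius
    [M], and contracting towards [q] by [k]; the weight [r = ramp e s] depends only on the
    level [s] of [x - q] along [v].  The values of [A] are orthogonal to [v], so
    the two terms vary in orthogonal directions, up to the error [D - v] and
    the change of weight of [A], both of which are absorbed by
    [drift_estimate]. *)
Lemma drift_map C q (f : H -> H) (D v : H) k M e :
  closed C -> convex_set C -> C q -> C (q + D) -> (forall x, C (f x)) ->
  (forall x y, `|f x - f y| <= `|x - y|) ->
  v != 0 -> dot (D - v) v = 0 -> `|D - v| <= 1 ->
  0 <= M -> 0 <= k < 1 -> 0 <= e <= 1 ->
  (M + 1) ^+ 2 <= e * (1 - k ^+ 2) * `|v| ^+ 2 ->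
  exists g : H -> H, [/\ forall x, C (g x),
    forall x y, `|g x - g y| <= `|x - y|,
    forall x, C x -> dot (x - q) v = 0 -> dot (f x - q) v = 0 ->
      `|f x - q| <= M -> g x - q = (1 - e) *: (k *: (f x - q)) + e *: D &
    exists b, [/\ `|b| <= M, dot b v = 0 &
      g (q + 2^-1 *: D) - q = ((1 - e) / 2) *: b + ((1 + e) / 2) *: D]].
Proof.
move=> clC cC Cq CD fC fN v0 Dv D1 M0 k01 e01 MV.
have k0 : 0 <= k by case/andP: k01.
have vp : 0 < `|v| by rewrite normr_gt0.
pose K := [set x | [/\ C x, `|x - q| <= M & dot (x - q) v = 0]].
have Kq : K q by split=> //; rewrite subrr ?normr0// dot0l.
have cvK : convex_set K by exact: convex_ball_slice.
have clK : closed K by exact: closed_ball_slice.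
have [P [PC Pid PN]] := projection clC cC (ex_intro _ q Cq).
have [Q [QK Qid QN]] := projection clK cvK (ex_intro _ q Kq).
pose s x := (dot (x - q) v : R) / `|v| ^+ 2.
pose A x := k *: (Q (f (P (x - s x *: v))) - q).
pose r x := ramp e (s x).
pose g x := q + ((1 - r x) *: A x + r x *: D).
have Av x : dot (A x) v = 0.
  by rewrite dotZl; have [_ _ ->] := QK (f (P (x - s x *: v))); rewrite mulr0.
have AM x : `|A x| <= M.
  rewrite normrZ ger0_norm//; have [_ h _] := QK (f (P (x - s x *: v))).
  have : k * `|Q (f (P (x - s x *: v))) - q| <= 1 * `|Q (f (P (x - s x *: v))) - q|.
    by rewrite ler_wpM2r//; lra.
  by rewrite mul1r => /le_trans; exact.
exists g; split.
- move=> x; have [r0 r1] := andP (ramp01 e (s x)).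
  have CA : C (q + A x).
    by apply: convex_segment => //; [have [] := QK (f (P (x - s x *: v)))|lra].
  have -> : g x = (q + A x) + r x *: ((q + D) - (q + A x)).
    rewrite /g opprD addrACA subrr add0r scalerBr scalerBl scale1r.
    by rewrite -!addrA; congr (_ + (_ + _)); rewrite addrC.
  by apply: convex_segment => //; rewrite r0.
- move=> x y.
  pose S := s x - s y; pose w := (x - s x *: v) - (y - s y *: v).
  have xyE : x - y = w + S *: v.
    rewrite /w /S opprB scalerBl; move: (s x *: v) (s y *: v) => a b.
    by rewrite addrAC (addrA (x - _)) (subrK a) addrA (subrK b).
  have sV z : s z * `|v| ^+ 2 = dot (z - q) v by rewrite divfK// expf_neq0// gt_eqF.
  have wv : dot w v = 0.
    have := sV x; have := sV y; rewrite /w !dotE -sqr_norm => -> ->; ring.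
  have AL : `|A x - A y| <= k * `|w|.
    rewrite /A -scalerBr normrZ ger0_norm// ler_wpM2l// opprB addrA subrK.
    by rewrite (le_trans (QN _ _))// (le_trans (fN _ _))// PN.
  pose a := (1 - r x) *: (A x - A y) + (r x - r y) *: (D - v - A y).
  have gE : g x - g y = a + (r x - r y) *: v.
    rewrite /g opprD addrACA subrr add0r opprD addrACA -scalerBl.
    rewrite /a -[RHS]addrA -scalerDr.
    have -> : D - v - A y + v = D - A y by rewrite addrAC subrK.
    have -> : (1 - r y) *: A y = (1 - r x) *: A y + (r x - r y) *: A y.
      by rewrite -scalerDl; congr (_ *: _); ring.
    by rewrite !scalerBr opprD addrA addrAC -!addrA.
  have av : dot a v = 0.
    rewrite dotDl !dotZl (dotDl (D - v)) (dotDl (A x)) Dv !dotNl !Av.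
    by rewrite oppr0 !addr0 !mulr0 addr0.
  have rL := ramp_lip (s x) (s y) e01.
  have /andP[r0 r1] : 0 <= r x <= 1 := ramp01 e (s x).
  have aL : `|a| <= k * `|w| + (M + 1) * `|S|.
    rewrite (le_trans (ler_normD _ _))// !normrZ ger0_norm ?subr_ge0//.
    have h1 : (1 - r x) * `|A x - A y| <= 1 * `|A x - A y|.
      by rewrite ler_wpM2r//; lra.
    have h2 : `|D - v - A y| <= M + 1.
      by rewrite (le_trans (ler_normB _ _))//; have := AM y; lra.
    have h3 : `|r x - r y| <= 1 * `|S|.
      by rewrite (le_trans rL)// ler_wpM2r//; lra.
    have h4 : `|r x - r y| * `|D - v - A y| <= `|S| * (M + 1).
      by apply: ler_pM => //; rewrite -[leRHS]mul1r.
    lra.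
  rewrite -(@ler_pXn2r _ 2)// ?nnegrE// gE xyE.
  rewrite (sqr_norm_slice _ av) (sqr_norm_slice _ wv).
  have := drift_estimate (normr_ge0 w) (normr_ge0 S) k01 e01 MV.
  rewrite [(`|S| * `|v|) ^+ 2]exprMn real_normK ?num_real// -exprMn.
  apply: le_trans; apply: lerD.
    rewrite ler_pXn2r ?nnegrE// addr_ge0 ?mulr_ge0//; lra.
  rewrite -[leLHS]real_normK ?num_real// normrM normr_id.
  have h5 : 0 <= (1 - e) * `|S| * `|v| by rewrite !mulr_ge0//; lra.
  rewrite ler_pXn2r ?nnegrE//.
  by rewrite ler_wpM2r.
- move=> x Cx xv fv fM.
  have sx : s x = 0 by rewrite /s xv mul0r.
  rewrite /g addrC addKr /r sx rampE// ?lexx ?ler01//.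
  rewrite mulr0 addr0 /A sx scale0r subr0.
  by rewrite (Pid x (mem_set Cx)) Qid// inE.
- exists (A (q + 2^-1 *: D)); split=> //.
  have Dvv : dot D v = `|v| ^+ 2.
    by rewrite -[in LHS](subrK v D) dotDl Dv add0r sqr_norm.
  have sE : s (q + 2^-1 *: D) = 2^-1.
    by rewrite /s (addrC q) addrK dotZl Dvv mulfK// expf_neq0// gt_eqF.
  rewrite /g (addrC q) addrK /r -/(g _) sE rampE//; last lra.
  by congr (_ *: _ + _ *: _); field.
Qed.

(** The image of the midpoint is the midpoint plus
    [E = ((1 - e) / 2) b + (e / 2) D].  Its inner product with [D] is of order
    [e r ^+ 2 = c r], whereas [`|E|] and hence its inner product with [y] stay
    bounded: for large [r] the former wins. *)
Lemma displacement_gap (D v b y : H) M N e c r :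
  dot (D - v) v = 0 -> `|D - v| <= 1 -> dot b v = 0 -> `|b| <= M ->
  `|D| = r -> `|y| <= N -> 0 <= e <= 1 -> e * r = c -> c <= 1 -> 2 <= r ->
  M + N * (M + 4) + 4 <= c * r / 2 ->
  `|2^-1 *: D - y| + r^-1 < `|((1 - e) / 2) *: b + ((1 + e) / 2) *: D - y|.
Proof.
move=> Dv D1 bv bM Dr yN e01 erc c1 r2 cr.
have r0 : 0 < r by lra.
have ri : r * r^-1 = 1 by rewrite mulfV// gt_eqF.
have ri0 : 0 < r^-1 by rewrite invr_gt0.
have ri1 : r^-1 <= 1 by rewrite invf_le1//; lra.
have N0 : 0 <= N by exact: le_trans yN.
have M0 : 0 <= M by exact: le_trans bM.
pose E := ((1 - e) / 2) *: b + (e / 2) *: D.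
have -> : ((1 - e) / 2) *: b + ((1 + e) / 2) *: D - y = (2^-1 *: D - y) + E.
  have -> : (1 + e) / 2 = 2^-1 + e / 2 by ring.
  by rewrite scalerDl -addrA (addrAC (2^-1 *: D)) addrCA.
have Tr : `|2^-1 *: D - y| <= r / 2 + N.
  by rewrite (le_trans (ler_normB _ _))// normrZ Dr ger0_norm//; lra.
(* Since [b] is orthogonal to [v], only [D - v] contributes. *)
have bD : - M <= dot b D.
  have -> : dot b D = dot b (D - v) by rewrite dotDr dotNr bv subr0.
  have := cauchy_schwarz b (D - v); rewrite ler_norml => /andP[+ _].
  apply: le_trans; rewrite lerN2 -[leRHS]mulr1; exact: ler_pM.
have EM : `|E| <= M / 2 + 1.
  rewrite (le_trans (ler_normD _ _))// !normrZ Dr !ger0_norm; try lra.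
  have : (1 - e) / 2 * `|b| <= 1 / 2 * M by apply: ler_pM => //; lra.
  lra.
have yE : dot y E <= N * (M / 2 + 1).
  by rewrite (le_trans (dot_le _ _))// ler_pM.
have DE : - M / 2 + c * r / 2 <= 2 * dot (2^-1 *: D) E.
  rewrite /E !dotE (dotC D b) -(sqr_norm D) Dr.
  have : 0 <= (1 - e) * (dot b D + M) by apply: mulr_ge0; lra.
  have : 0 <= e * M by apply: mulr_ge0; lra.
  have -> : e / 2 * r ^+ 2 = c * r / 2 by rewrite -erc expr2; field.
  lra.
have Er := sqr_ge0 `|E|.
have T0 := normr_ge0 (2^-1 *: D - y).
rewrite -(@ltr_pXn2r _ 2)// ?nnegrE ?addr_ge0 ?(ltW ri0)//.
rewrite [ltRHS]sqr_normD dotDl dotNl.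
move: (`|2^-1 *: D - y|) Tr T0 => T Tr T0.
have Nr : 0 <= N * (1 - r^-1) by apply: mulr_ge0; lra.
have Tr1 : T * r^-1 <= 1 / 2 + N.
  have : T * r^-1 <= (r / 2 + N) * r^-1 by rewrite ler_pM2r.
  lra.
have rr1 : r^-1 * r^-1 <= 1 * 1 by apply: ler_pM => //; lra.
lra.
Qed.

(** The contraction [k] and the drift [e r] may each change the values of a map
    by at most [c / 4].  With these constraints [e * r ^+ 2] equals [c r / 4]
    and grows with [r], so the bound required by [drift_estimate] and the gap of
    [displacement_gap] both hold for large [r]. *)
Lemma drift_parameters c m M : 0 < c <= 1 -> 1 <= m -> 0 <= M ->
  exists k e r, [/\ 0 <= k < 1, 0 <= e <= 1 & 2 <= r] /\
    [/\ (1 - k) * m = c / 4, e * r = c / 4,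
        m ^+ 2 <= e * (1 - k ^+ 2) * (r ^+ 2 / 2) &
        8 * (m + M * (m + 4) + 4) <= c * r].
Proof.
move=> /andP[c0 c1] m1 M0.
have mp : 0 < m by lra.
have c2 : 0 < c ^+ 2 by exact: exprn_gt0.
pose n := m + M * (m + 4) + 4.
have n0 : 0 <= n.
  have : 0 <= M * (m + 4) by apply: mulr_ge0 => //; lra.
  by rewrite /n; lra.
pose r := 32 * m ^+ 3 / c ^+ 2 + 8 / c * n + 2.
have h1 : 0 <= 32 * m ^+ 3 / c ^+ 2.
  by rewrite divr_ge0 ?(ltW c2)// mulr_ge0// exprn_ge0// ltW.
have h3 : 0 <= 8 / c * n by rewrite mulr_ge0// divr_ge0// ltW.
have r2 : 2 <= r by rewrite /r; lra.
have rp : 0 < r by lra.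
have rc : 8 * n <= c * r.
  have : 0 <= c * (32 * m ^+ 3 / c ^+ 2) by rewrite mulr_ge0// ltW.
  have -> : c * r = c * (32 * m ^+ 3 / c ^+ 2) + 8 * n + 2 * c.
    by rewrite /r; field; rewrite gt_eqF.
  lra.
have rm : 32 * m ^+ 3 <= c ^+ 2 * r.
  have : 0 <= c ^+ 2 * (8 / c * n) by rewrite mulr_ge0// ltW.
  have -> : c ^+ 2 * r = 32 * m ^+ 3 + c ^+ 2 * (8 / c * n) + 2 * c ^+ 2.
    by rewrite /r; field; rewrite gt_eqF.
  lra.
clearbody r; clear h1 h3.
pose e := c / (4 * r); pose k := 1 - c / (4 * m).
have er : e * r = c / 4 by rewrite /e; field; rewrite gt_eqF.
have km : (1 - k) * m = c / 4 by rewrite /k; field; rewrite gt_eqF.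
have e0 : 0 < e by rewrite divr_gt0// mulr_gt0.
have e1 : e <= 1.
  have : e * 2 <= e * r by rewrite ler_wpM2l// ltW.
  lra.
have k1 : k < 1 by rewrite /k gtrBl divr_gt0// mulr_gt0.
have k0 : 0 <= k.
  have : (1 - k) * 1 <= (1 - k) * m by rewrite ler_wpM2l// subr_ge0 ltW.
  lra.
exists k, e, r; rewrite k0 (ltW e0); split; split=> //.
have k2 : 1 - k <= 1 - k ^+ 2 by rewrite lerD2l lerN2 expr2 ler_piMl// ltW.
apply: (@le_trans _ _ (e * (1 - k) * (r ^+ 2 / 2))); last first.
  by rewrite ler_wpM2r ?divr_ge0 ?sqr_ge0// ler_wpM2l// ltW.
have -> : e * (1 - k) * (r ^+ 2 / 2) = c ^+ 2 * r / (32 * m).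
  by rewrite /e /k; field; rewrite !gt_eqF.
rewrite ler_pdivlMr ?mulr_gt0//.
by have -> : m ^+ 2 * (32 * m) = 32 * m ^+ 3 by ring.
Qed.

(** The drift is taken along a displacement almost orthogonal to the given
    points and to their images, so that [g] is explicitly known there. *)
Lemma escape_perturbation C q (f : H -> H) (xs : seq H) c M :
  closed C -> convex_set C -> C q -> escapes C q -> (forall x, C (f x)) ->
  (forall x y, `|f x - f y| <= `|x - y|) -> {in xs, forall x, C x} ->
  0 < c -> 0 <= M ->
  exists g : H -> H, [/\ forall x, C (g x),
    forall x y, `|g x - g y| <= `|x - y|,
    {in xs, forall x, `|g x - f x| < c} &
    exists a t, [/\ C a, 0 < t &
      forall w, `|w - q| <= M -> `|a - w| + t < `|g a - w|]].
Proof.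
move=> clC cC Cq esc fC fN xsC c0 M0.
wlog c1 : c c0 / c <= 1.
  move=> h; have [c1|/ltW c1] := leP c 1; first exact: h.
  have [g [gC gN gf ga]] := h 1 ltr01 (lexx 1).
  by exists g; split=> // x /gf/lt_le_trans; apply.
pose m := \sum_(x <- xs) `|f x - q| + 1.
have m1 : 1 <= m by rewrite lerDr sumr_ge0.
have fm : {in xs, forall x, `|f x - q| <= m - 1}.
  by move=> x xX; rewrite addrK (big_rem x xX)/= lerDl sumr_ge0.
have [k [e [r [[k01 e01 r2] [km er mk rc]]]]] : exists k e r, _ /\ _ :=
  drift_parameters (introT andP (conj c0 c1)) m1 M0.
clearbody m.
have rp : 0 < r by lra.
pose X := [seq x - q | x <- xs] ++ [seq f x - q | x <- xs].
have [u [v [Cu ur vX Dv D1]]] := escape_direction X cC Cq esc rp.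
set D := u - q in ur Dv D1.
have vr : r ^+ 2 / 2 <= `|v| ^+ 2.
  have : r ^+ 2 = `|D - v| ^+ 2 + (1 * `|v|) ^+ 2.
    by rewrite -(sqr_norm_slice _ Dv) scale1r subrK ur.
  have : `|D - v| ^+ 2 <= 1 by rewrite expr_le1.
  have : 2 * 2 <= r ^+ 2 by rewrite expr2; apply: ler_pM; lra.
  rewrite mul1r; lra.
have v0 : v != 0.
  apply/eqP => v0; move: vr; rewrite v0 normr0 expr0n/= leNgt.
  by rewrite divr_gt0// exprn_gt0.
have mv : (m - 1 + 1) ^+ 2 <= e * (1 - k ^+ 2) * `|v| ^+ 2.
  have /andP[k0 /ltW k1] := k01; have /andP[e0 _] := e01.
  by rewrite subrK (le_trans mk)// ler_wpM2l// mulr_ge0// subr_ge0 expr_le1.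
have CD : C (q + D) by rewrite /D addrC subrK.
have m0 : 0 <= m - 1 by rewrite subr_ge0.
have [g [gC gN gx [b [bm bv gb]]]] :=
  drift_map clC cC Cq CD fC fN v0 Dv D1 m0 k01 e01 mv.
exists g; split=> // [x xX|].
  have fx := fm x xX.
  have -> : g x - f x = (g x - q) - (f x - q) by rewrite opprB addrA subrK.
  rewrite gx//; last 3 first.
  - exact: xsC.
  - by rewrite dotC vX// mem_cat (map_f (fun x => x - q) xX).
  - by rewrite dotC vX// mem_cat (map_f (fun x => f x - q) xX) orbT.
  move: (f x - q) fx => z fx.
  have -> : (1 - e) *: (k *: z) + e *: D - z = e *: D - (1 - (1 - e) * k) *: z.
    by rewrite scalerA [in RHS]scalerBl scale1r opprB [RHS]addrA (addrC (e *: D)).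
  have s1 : (1 - (1 - e) * k) * `|z| <= (1 - k + e) * m.
    clear -e01 k01 fx m1.
    have s2 : 0 <= e * (1 - k) by apply: mulr_ge0; lra.
    have s3 : 0 <= e * k by apply: mulr_ge0; lra.
    apply: ler_pM => //; lra.
  have s4 : e * m <= e * r.
    rewrite ler_wpM2l//; first by case/andP: e01.
    clear -c0 c1 rc M0 m1 rp.
    have : 0 <= (1 - c) * r by apply: mulr_ge0; lra.
    have : 0 <= M * (m + 4) by apply: mulr_ge0; lra.
    lra.
  have s5 : 0 <= 1 - (1 - e) * k.
    clear -e01 k01.
    have : 0 <= e * k by apply: mulr_ge0; lra.
    lra.
  rewrite (le_lt_trans (ler_normB _ _))//.
  rewrite !normrZ ur ger0_norm; last by case/andP: e01.
  rewrite ger0_norm//; clear -s1 s4 er km c0; lra.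
exists (q + 2^-1 *: D), r^-1; split.
- by apply: convex_segment => //; lra.
- by rewrite invr_gt0.
- move=> w wM; set a := q + _.
  have -> : a - w = 2^-1 *: D - (w - q) by rewrite opprB /a (addrC q) -addrA.
  have -> : g a - w = (g a - q) - (w - q) by rewrite opprB addrA subrK.
  rewrite gb; apply: (displacement_gap Dv D1 bv bm ur wM e01 er) => //.
    by clear -c1; lra.
  clear -rc M0; lra.
Qed.

End hilbert.

(** * The space of nonexpansive maps *)

Section nonexp_maps.
Context {R : realType} {H : completeNormedModType R}.
Variable dot : {dot H for idfun}.
Hypothesis dot_norm : forall x : H, `|x| = Num.sqrt (dot x x).
Variable C : set H.
Hypotheses (C_closed : closed C) (C_convex : convex_set C).

Lemma nonexp_of_map (g : H -> H) : (forall x, C (g x)) ->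
  (forall x y, `|g x - g y| <= `|x - y|) ->
  exists G : nonexp C, forall x : C, val ((val G : C -> C) x) = g (val x).
Proof.
move=> gC gN; pose G0 : {ptws C -> C} := fun x : C => SigSub (mem_set (gC (val x))).
have G0N : G0 \in [set f : {ptws C -> C} | nonexpansive f].
  by apply/mem_set => x y; exact: gN.
by exists (SigSub G0N).
Qed.

(** Precomposing with the projection on [C] gives a nonexpansive map defined
    on the whole space, which spares subtypes in the geometric arguments. *)
Lemma map_of_nonexp (f : nonexp C) : C !=set0 ->
  exists F : H -> H, [/\ forall x, C (F x),
    forall x y, `|F x - F y| <= `|x - y| &
    forall x : C, F (val x) = val ((val f : C -> C) x)].
Proof.
move=> C0; have [P [PC Pid PN]] := projection dot_norm C_closed C_convex C0.
have fN : nonexpansive (val f : C -> C) by exact: set_mem (valP f).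
exists (fun x => val ((val f : C -> C) (SigSub (mem_set (PC x))))); split.
- by move=> x; apply: set_mem; exact: valP.
- by move=> x y; rewrite (le_trans (fN _ _))//; exact: PN.
- move=> x; have -> // : SigSub (mem_set (PC (val x))) = x.
  by apply: val_inj; apply: Pid; exact: valP.
Qed.

Lemma meager_of_escape q : C q -> escapes dot C q -> meager (with_fixpoint C).
Proof.
move=> Cq esc.
pose F (n : nat) := [set f : nonexp C |
  exists2 x : C, (val f : C -> C) x = x & `|val x - q| <= n%:R].
exists F; last first.
  apply/seteqP; split=> [f [x fx]|f [n _ [x fx _]]]; last by exists x.
  exists (Num.truncn `|val x - q|).+1 => //; exists x => //.
  by rewrite ltW// truncnS_gt.
move=> n; rewrite /nowhere_dense -subset0 => f.
rewrite /interior => /nbhs_nonexp[s [e [e0 sF]]].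
have [f' [fC fN fE]] := map_of_nonexp f (ex_intro _ q Cq).
have sC : {in [seq val x | x <- s], forall x, C x}.
  by move=> _ /mapP[x _ ->]; apply: set_mem; exact: valP.
have [g [gC gN gf [a [t [Ca t0 at_far]]]]] := escape_perturbation dot_norm
  C_closed C_convex Cq esc fC fN sC e0 (ler0n R n).
have [G GE] := nonexp_of_map gC gN.
have : closure (F n) G.
  by apply: sF => x xs; rewrite GE -fE; apply: gf; exact: map_f.
pose a' : C := SigSub (mem_set Ca).
have nG : nbhs G [set h : nonexp C |
    `|val ((val h : C -> C) a') - val ((val G : C -> C) a')| < t].
  by apply/nbhs_nonexp; exists [:: a'], t; split=> // h; apply; rewrite mem_head.
move=> /(_ _ nG)[h [[w hw wn]]] /=; rewrite GE/= => ht.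
have hN : nonexpansive (val h : C -> C) by exact: set_mem (valP h).
have hw' : `|val ((val h : C -> C) a') - val w| <= `|a - val w|.
  by have := hN a' w; rewrite hw.
have := at_far _ wn; move: ht hw'; rewrite distrC.
by have := ler_distD (val ((val h : C -> C) a')) (g a) (val w); lra.
Qed.

Lemma open_dense_of_no_escape q : C q -> ~ escapes dot C q ->
  exists U : set (nonexp C), [/\ open U, dense U & U `<=` with_fixpoint C].
Proof.
move=> Cq nesc; exists (with_fixpoint C)°; split.
- exact: open_interior.
- move=> O [f Of] Oo.
  have /nbhs_nonexp[s [e [e0 sO]]] : nbhs f O by exact: open_nbhs_nbhs.
  have [f' [fC fN fE]] := map_of_nonexp f (ex_intro _ q Cq).
  pose m := \sum_(x <- s) `|f' (val x) - q|.
  have m0 : 0 <= m by exact: sumr_ge0.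
  have fm : {in s, forall x, `|f' (val x) - q| <= m}.
    by move=> x xs; rewrite /m (big_rem x xs)/= lerDl sumr_ge0.
  (* Orthogonality to [0] is no constraint: [K] is the ball of [C]. *)
  pose K := [set x | [/\ C x, `|x - q| <= m & dot (x - q) 0 = 0]].
  have Kq : K q by split=> //; rewrite subrr ?normr0// dot0l.
  have clK : closed K by exact: closed_ball_slice.
  have cvK : convex_set K by exact: convex_ball_slice.
  have [Q [QK Qid QN]] := projection dot_norm clK cvK (ex_intro _ q Kq).
  have QfC x : C (Q (f' x)) by have [] := QK (f' x).
  have QfN x y : `|Q (f' x) - Q (f' y)| <= `|x - y| by rewrite (le_trans (QN _ _)).
  have [G GE] := nonexp_of_map QfC QfN.
  exists G; split.
    apply: sO => x xs; rewrite GE -fE Qid ?subrr ?normr0//.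
    by apply: mem_set; split; rewrite ?fm// dotC dot0l.
  have m10 : 0 <= m + 1 by lra.
  have [cs csC csP] := fixpoint_of_finite_constraint dot_norm C_closed
    C_convex Cq m10 nesc.
  have [P [PC Pid PN]] := projection dot_norm C_closed C_convex (ex_intro _ q Cq).
  apply/nbhs_nonexp.
  exists [seq SigSub (mem_set (PC x)) | x <- cs], 1; split=> // h hG.
  have [h' [hC hN hE]] := map_of_nonexp h (ex_intro _ q Cq).
  have [|x Cx hx] := csP h' hC hN.
    move=> p pcs; have := hG _ (map_f (fun x => SigSub (mem_set (PC x))) pcs).
    rewrite GE -hE/= Pid; last exact/mem_set/csC.
    have [_ Qm _] := QK (f' p).
    have := ler_distD (Q (f' p)) (h' p) q; lra.
  exists (SigSub (mem_set Cx)); apply: val_inj.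
  by rewrite -hE.
- exact: interior_subset.
Qed.

End nonexp_maps.

Theorem theorem4p2 (R : realType) (H : completeNormedModType R)
    (dot : {dot H for idfun})
    (dot_norm : forall x : H, `|x| = Num.sqrt (dot x x))
    (H_separable : separable H)
    (H_infinite : ~ finite_dimensional H)
    (C : set H) (C_closed : closed C) (C_convex : convex_set C) :
  meager (with_fixpoint C) \/
  exists U : set (nonexp C),
    [/\ open U, dense U & U `<=` with_fixpoint C].
Proof.
have [[q Cq]|C0] := pselect (C !=set0); last first.
  left; exists (fun=> set0).
    by move=> n; rewrite /nowhere_dense closure0 interior0.
  apply/seteqP; split=> [f [x _]|f [n _ //]].
  by case: C0; exists (val x); apply: set_mem; exact: valP.
have [esc|nesc] := pselect (escapes dot C q).
  by left; exact: (meager_of_escape dot_norm C_closed C_convex Cq esc).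
by right; exact: (open_dense_of_no_escape dot_norm C_closed C_convex Cq nesc).
Qed.
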